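(* Let $R>1$, and let $u$ be the vector field on $\Omega\setminus\{(0,0)\}$ described in the context. For every $c$ with $1\le c\le R$, at each point other than the origin of the circle of radius $c$ centred at $(c,0)$, the components of $u$ with respect to polar coordinates $(\rho,\phi)$ based at the centre $(c,0)$ are $$u_\rho=0,\qquad u_\phi=-c,$$ so that $u$ has constant magnitude $c$ on that circle and is tangential to it in the clockwise direction. Equivalently, at such points $$u(x_1,x_2)=c\,e_2+(x_2e_1-x_1e_2),$$ that is, $u$ restricted to the circle is an (infinitesimal) rigid body displacement consisting of a translation of amount $c$ in the $x_2$-direction plus a unit clockwise rotation about the origin.
   Context: Fix $R>1$. $\Omega\subset\mathbb{R}^2$ is the lens-shaped region filled by the circles $(x_1-c)^2+x_2^2=c^2$, $1\le c\le R$, which all touch at the origin. Each point of $\Omega\setminus\{(0,0)\}$ lies on exactly one of these circles and has $x_1>0$. The vector field $u=(u_1,u_2)$ on $\Omega\setminus\{(0,0)\}$ is $u_1=x_2$, $u_2=\frac{x_2^2-x_1^2}{2x_1}$. The vectors $e_1,e_2$ are the standard Cartesian base vectors. For given $c$, polar coordinates $(\rho,\phi)$ are defined by $x_1=c+\rho\cos\phi$, $x_2=\rho\sin\phi$, and $u_\rho=u_1\cos\phi+u_2\sin\phi$, $u_\phi=-u_1\sin\phi+u_2\cos\phi$. *)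

(* Defs.v *)
From Stdlib Require Import Reals.
From Coquelicot Require Import Coquelicot.
Open Scope R_scope.

(* Coquelicot's structure on R * R: [plus], [minus], [scal] act componentwise
   and [norm] is the Euclidean norm. *)
Definition e1 : R * R := (1, 0).
Definition e2 : R * R := (0, 1).
Definition origin : R * R := (0, 0).

Definition circle (c : R) (x : R * R) : Prop :=
  (fst x - c) ^ 2 + snd x ^ 2 = c ^ 2.

Definition Omega (Rad : R) (x : R * R) : Prop :=
  exists c : R, 1 <= c <= Rad /\ circle c x.

(* The field lives on Omega minus the origin only: [u] is constrained there
   and arbitrary elsewhere. *)
Definition lens_field (Rad : R) (u : R * R -> R * R) : Prop :=
  forall x : R * R, Omega Rad x -> x <> origin ->
    fst (u x) = snd x /\
    snd (u x) = (snd x ^ 2 - fst x ^ 2) / (2 * fst x).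

(* The angle is not normalised: every admissible phi is allowed. *)
Definition polar_coords (c : R) (x : R * R) (rho phi : R) : Prop :=
  0 < rho /\ fst x = c + rho * cos phi /\ snd x = rho * sin phi.

Definition rho_component (v : R * R) (phi : R) : R :=
  fst v * cos phi + snd v * sin phi.

Definition phi_component (v : R * R) (phi : R) : R :=
  - fst v * sin phi + snd v * cos phi.

(* For c > 0, the counterclockwise parametrisation of [circle c]. *)
Definition circle_param (c t : R) : R * R := (c + c * cos t, c * sin t).

(* v is a negative multiple of the counterclockwise velocity at x. *)
Definition clockwise_tangent (c : R) (x v : R * R) : Prop :=
  exists (t k : R) (w : R * R),
    circle_param c t = x /\ is_derive (circle_param c) t w /\
    k < 0 /\ v = scal k w.

(* Rotation about the origin, counterclockwise for positive angles. *)
Definition rotate (theta : R) (x : R * R) : R * R :=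
  (cos theta * fst x - sin theta * snd x,
   sin theta * fst x + cos theta * snd x).

(* Initial velocity field of the rotation about the origin with angular
   velocity omega; omega < 0 is clockwise. *)
Definition infinitesimal_rotation (omega : R) (w : R * R -> R * R) : Prop :=
  forall x : R * R, is_derive (fun t : R => rotate (omega * t) x) 0 (w x).

(* On A, v is the translation b plus the infinitesimal rotation omega. *)
Definition rigid_displacement_on (A : R * R -> Prop) (v : R * R -> R * R)
    (b : R * R) (omega : R) : Prop :=
  exists w : R * R -> R * R,
    infinitesimal_rotation omega w /\
    forall x : R * R, A x -> v x = plus b (w x).

(* Main.v *)
Require Import Defs.
From Stdlib Require Import Reals Lra.
From Coquelicot Require Import Coquelicot.
Open Scope R_scope.

(** On the circle of radius [c] one has [x2^2 = 2 c x1 - x1^2], so the quotient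
    defining the second component of the field simplifies to [c - x1]: there
    the field is [(x2, c - x1)] (lemma [lens_field_on_circle]).  This is the
    radius vector [(x1 - c, x2)] turned clockwise by a right angle, hence
    tangential and of magnitude [c]; regrouped as [(0, c) + (x2, - x1)], it is
    the translation by [c] in the second direction plus the velocity of the
    unit clockwise rotation about the origin. *)

Lemma circle_fst_neq0 (c : R) (x : R * R) :
  circle c x -> x <> origin -> fst x <> 0.
Proof.
  destruct x as [a b]; unfold circle, origin; simpl.
  intros H Hn ->; apply Hn; f_equal; nra.
Qed.

Lemma lens_field_on_circle (Rad : R) (u : R * R -> R * R) (c : R) (x : R * R) :
  lens_field Rad u -> 1 <= c <= Rad -> circle c x -> x <> origin ->
  u x = (snd x, c - fst x).
Proof.
  intros hu hc Hx Hn.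
  pose proof (circle_fst_neq0 c x Hx Hn) as H0.
  destruct (hu x (ex_intro _ c (conj hc Hx)) Hn) as [E1 E2].
  rewrite (surjective_pairing (u x)), E1, E2; f_equal.
  unfold circle in Hx.
  replace (snd x ^ 2) with (2 * c * fst x - fst x ^ 2) by nra.
  field; exact H0.
Qed.

Lemma exists_angle (a b : R) :
  a ^ 2 + b ^ 2 = 1 -> exists t : R, cos t = a /\ sin t = b.
Proof.
  intros H.
  assert (Ha : -1 <= a <= 1) by nra.
  assert (Hs : sqrt (1 - a²) = Rabs b).
  { rewrite <- sqrt_Rsqr_abs; f_equal; unfold Rsqr; lra. }
  (* [acos a] lies in [0, PI], so it serves only for a nonnegative sine. *)
  destruct (Rle_dec 0 b) as [Hb | Hb].
  - exists (acos a).
    rewrite cos_acos, sin_acos, Hs, Rabs_pos_eq by assumption; auto.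
  - exists (- acos a).
    rewrite cos_neg, sin_neg, cos_acos, sin_acos, Hs, Rabs_left by lra.
    split; ring.
Qed.

Lemma is_derive_pair (f g : R -> R) (t df dg : R) :
  is_derive f t df -> is_derive g t dg ->
  is_derive (fun s => (f s, g s)) t (df, dg).
Proof.
  intros Hf Hg; unfold is_derive.
  apply (filterdiff_ext_lin _ (fun y : R => (scal y df, scal y dg)));
    [ | reflexivity ].
  apply (filterdiff_comp_2 f g pair _ _ pair); try assumption.
  (* The uncurried [pair] is the identity of [R * R], its own differential. *)
  apply (filterdiff_ext (fun p : R * R => p));
    [ intros [a b]; reflexivity | ].
  apply (filterdiff_ext_lin _ (fun p : R * R => p));
    [ apply filterdiff_id | intros [a b]; reflexivity ].
Qed.

Lemma is_derive_circle_param (c t : R) :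
  is_derive (circle_param c) t (- (c * sin t), c * cos t).
Proof.
  apply is_derive_pair; auto_derive; auto; ring.
Qed.

Lemma infinitesimal_rotation_clockwise :
  infinitesimal_rotation (-1) (fun x => (snd x, - fst x)).
Proof.
  intros x; apply is_derive_pair; auto_derive; auto;
    rewrite Rmult_0_r, sin_0, cos_0; ring.
Qed.

Lemma polar_radius_on_circle (c : R) (x : R * R) (rho phi : R) :
  0 < c -> circle c x -> polar_coords c x rho phi -> rho = c.
Proof.
  unfold circle; intros Hc Hx (Hr & E1 & E2).
  rewrite E1, E2 in Hx.
  pose proof (sin2_cos2 phi) as Hsc; unfold Rsqr in Hsc.
  assert (rho ^ 2 = c ^ 2).
  { rewrite <- Hx.
    replace (rho ^ 2) with (rho ^ 2 * (sin phi * sin phi + cos phi * cos phi))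
      by (rewrite Hsc; ring).
    ring. }
  nra.
Qed.

Lemma clockwise_tangent_on_circle (c : R) (x : R * R) :
  0 < c -> circle c x -> clockwise_tangent c x (snd x, c - fst x).
Proof.
  destruct x as [a b]; unfold circle; simpl fst; simpl snd; intros Hc Hx.
  destruct (exists_angle ((a - c) / c) (b / c)) as (t & Et & Es).
  { replace (((a - c) / c) ^ 2 + (b / c) ^ 2)
      with (((a - c) ^ 2 + b ^ 2) / c ^ 2) by (field; lra).
    rewrite Hx; field; lra. }
  (* The parametrisation has speed [c], so the factor is exactly [-1]. *)
  exists t, (-1), (- (c * sin t), c * cos t).
  split; [ | split; [ apply is_derive_circle_param | split; [ lra | ] ] ].
  - unfold circle_param; rewrite Et, Es; f_equal; field; lra.
  - unfold scal; simpl; unfold prod_scal; simpl.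
    unfold scal; simpl; unfold mult; simpl.
    rewrite Et, Es; f_equal; field; lra.
Qed.

Theorem mainTheorem2 (Rad : R) (hRad : 1 < Rad)
    (u : R * R -> R * R) (hu : lens_field Rad u)
    (c : R) (hc : 1 <= c <= Rad) :
  (forall x : R * R, circle c x -> x <> origin ->
     (forall rho phi : R, polar_coords c x rho phi ->
        rho_component (u x) phi = 0 /\ phi_component (u x) phi = - c) /\
     norm (u x) = c /\
     clockwise_tangent c x (u x) /\
     u x = plus (scal c e2) (minus (scal (snd x) e1) (scal (fst x) e2))) /\
  rigid_displacement_on (fun x : R * R => circle c x /\ x <> origin) u
    (scal c e2) (-1).
Proof.
  assert (Hc : 0 < c) by lra.
  split.
  - intros x Hx Hn.
    rewrite (lens_field_on_circle Rad u c x hu hc Hx Hn).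
    split; [ | split; [ | split ] ].
    + intros rho phi Hp.
      pose proof (polar_radius_on_circle c x rho phi Hc Hx Hp) as ->.
      destruct Hp as (_ & E1 & E2).
      pose proof (sin2_cos2 phi) as Hsc; unfold Rsqr in Hsc.
      unfold rho_component, phi_component; simpl; rewrite E1, E2.
      split; [ ring | ].
      replace (- c) with (- c * (sin phi * sin phi + cos phi * cos phi))
        by (rewrite Hsc; ring).
      ring.
    + change (sqrt (Rabs (snd x) ^ 2 + Rabs (c - fst x) ^ 2) = c).
      rewrite !pow2_abs.
      replace (snd x ^ 2 + (c - fst x) ^ 2) with (c ^ 2)
        by (unfold circle in Hx; nra).
      apply sqrt_pow2; lra.
    + apply clockwise_tangent_on_circle; assumption.
    + unfold e1, e2, minus, plus, opp, scal; simpl.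
      unfold prod_plus, prod_opp, prod_scal, scal, plus, opp, mult; simpl.
      unfold mult; simpl; f_equal; ring.
  - exists (fun x => (snd x, - fst x)).
    split; [ exact infinitesimal_rotation_clockwise | ].
    intros x [Hx Hn].
    rewrite (lens_field_on_circle Rad u c x hu hc Hx Hn).
    unfold e2, plus, scal; simpl.
    unfold prod_plus, prod_scal, scal, plus, mult; simpl.
    unfold mult; simpl; f_equal; ring.
Qed.
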